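(* Let $N_{\mathrm S}\ge 1$ and $N_{\mathrm T}=N_{\mathrm T}^{\mathsf x}N_{\mathrm T}^{\mathsf y}\ge N_{\mathrm S}$ be integers, let $P_{\mathrm{Tx}}>0$ and $\sigma_{\mathsf n}^2>0$, and let $\mathbf h_\ell=\alpha_\ell\mathbf a_\ell\in\mathbb C^{N_{\mathrm T}}$, $\ell=1,\dots,N_{\mathrm S}$, be channel vectors with gains $\alpha_\ell\in\mathbb C$ and steering vectors $\mathbf a_\ell$ as described in the context. Suppose that for all $i\neq\ell$ the steering vectors are orthogonal, $\mathbf a_i^H\mathbf a_\ell=0$, and the path losses are the same, $|\alpha_i|^2=|\alpha_\ell|^2$. Then the precoder with perfect position knowledge, $$\mathbf g_\ell^{\mathrm{per}}=\beta\left(\sum_{i=1}^{N_{\mathrm S}}\sigma_{\alpha_i}^2\mathbf a_i\mathbf a_i^H+\frac{N_{\mathrm S}\sigma_{\mathsf n}^2}{P_{\mathrm{Tx}}}\mathbf I_{N_{\mathrm T}}\right)^{-1}\mathbf a_\ell,\qquad \ell=1,\dots,N_{\mathrm S},$$ where $\beta$ is chosen (for each $\ell$) such that $(\mathbf g_\ell^{\mathrm{per}})^H\mathbf g_\ell^{\mathrm{per}}=P_{\mathrm{Tx}}/N_{\mathrm S}$, is capacity achieving; that is, its achievable sum rate $R$ equals the channel capacity $C$ (both defined in the context).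
   Context: A terminal with a uniform rectangular array of $N_{\mathrm T}=N_{\mathrm T}^{\mathsf x}N_{\mathrm T}^{\mathsf y}$ antennas transmits to $N_{\mathrm S}\le N_{\mathrm T}$ single-antenna satellites. The channel to satellite $\ell$ is $\mathbf h_\ell=\alpha_\ell\mathbf a_\ell$ with complex scalar gain $\alpha_\ell$, $\sigma_{\alpha_\ell}^2=\mathbb E\{|\alpha_\ell|^2\}$ being its variance, and steering vector $\mathbf a_\ell=\mathbf a_\ell^{\mathsf x}\otimes\mathbf a_\ell^{\mathsf y}$ (Kronecker product), whose factors have entries $a_{\ell,m}^{\mathsf x}=e^{-j\nu D_{\mathrm A}(m-1)\phi_\ell^{\mathsf x}}$ for $m=1,\dots,N_{\mathrm T}^{\mathsf x}$ and $a_{\ell,n}^{\mathsf y}=e^{-j\nu D_{\mathrm A}(n-1)\phi_\ell^{\mathsf y}}$ for $n=1,\dots,N_{\mathrm T}^{\mathsf y}$, where $j$ is the imaginary unit, $\nu>0$ is the wavenumber, $D_{\mathrm A}>0$ is the antenna spacing and $\phi_\ell^{\mathsf x},\phi_\ell^{\mathsf y}\in\mathbb R$ are the space angles; in particular all entries of $\mathbf a_\ell$ have modulus one. The steering vectors are perfectly known. Below, $\alpha_\ell$ denotes the realized gain. Sum rate: for precoding vectors $\mathbf g_1,\dots,\mathbf g_{N_{\mathrm S}}\in\mathbb C^{N_{\mathrm T}}$ (one independent data stream per satellite, interference treated as noise), $R=\sum_{\ell=1}^{N_{\mathrm S}}\log_2(1+\Gamma_\ell)$ with $$\Gamma_\ell=\frac{|\mathbf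 h_\ell^H\mathbf g_\ell|^2}{\sum_{i\neq\ell}|\mathbf h_\ell^H\mathbf g_i|^2+\sigma_{\mathsf n}^2}.$$ Capacity: with $\mathbf H=[\mathbf h_1,\dots,\mathbf h_{N_{\mathrm S}}]^H$ and $\lambda_1,\dots,\lambda_{N_{\mathrm S}}$ the eigenvalues of $\mathbf H\mathbf H^H$, $$C=\max\left\{\sum_{\mu=1}^{N_{\mathrm S}}\log_2\left(1+\lambda_\mu\frac{p_\mu}{\sigma_{\mathsf n}^2}\right): p_\mu\ge 0,\ \sum_{\mu=1}^{N_{\mathrm S}}p_\mu=P_{\mathrm{Tx}}\right\}$$ (the maximizing power allocation is given by water-filling). $\mathbf I_N$ is the $N\times N$ identity matrix and $(\cdot)^H$ denotes conjugate transpose. *)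

(* Defs.v *)
From HB Require Import structures.
From mathcomp Require Import all_boot all_order all_algebra.
From mathcomp Require Import spectral.
From mathcomp Require Import complex mxtens.
From mathcomp Require Import all_classical all_reals all_analysis.

Set Implicit Arguments.
Unset Strict Implicit.
Unset Printing Implicit Defensive.

Import Order.TTheory GRing.Theory Num.Theory.

Local Open Scope classical_set_scope.
Local Open Scope ring_scope.
Local Open Scope complex_scope.
Local Open Scope sesquilinear_scope.

Definition log2 (R : realType) (x : R) : R := ln x / ln 2.

(* exp (j t), by Euler's formula *)
Definition expj (R : realType) (t : R) : R[i] := cos t +i* sin t.

(* the norm of R[i] takes its values in R[i] *)
Definition sqnorm (R : realType) (z : R[i]) : R := complex.Re (`|z| ^+ 2).

Definition hdot (R : realType) (n : nat) (u v : 'cV[R[i]]_n) : R[i] :=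
  (u ^t* *m v) 0 0.

Definition complex_random_variable (d : measure_display) (T : measurableType d)
    (R : realType) (X : T -> R[i]) : Prop :=
  measurable_fun [set: T] (fun w => complex.Re (X w)) /\
  measurable_fun [set: T] (fun w => complex.Im (X w)).

Definition finite_second_moment (d : measure_display) (T : measurableType d)
    (R : realType) (P : probability T R) (X : T -> R[i]) : Prop :=
  P.-integrable [set: T] (fun w => (sqnorm (X w))%:E).

(* E{|X|^2}, without centering *)
Definition second_moment (d : measure_display) (T : measurableType d)
    (R : realType) (P : probability T R) (X : T -> R[i]) : R :=
  fine ('E_P[(fun w => sqnorm (X w))])%E.

(* Antennas are indexed from 0, so m - 1 in a one-based numbering is the
   value of the ordinal. *)
Definition linear_steering (R : realType) (nu DA : R) (n : nat) (phi : R) :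
    'cV[R[i]]_n :=
  \col_(m < n) expj (- (nu * DA * m%:R * phi)).

(* The Kronecker product of columns has width 1 * 1, which is convertible
   to 1. *)
Definition steering (R : realType) (nu DA : R) (Nx Ny : nat) (phix phiy : R) :
    'cV[R[i]]_(Nx * Ny) :=
  linear_steering nu DA Nx phix *t linear_steering nu DA Ny phiy.

Definition channel_matrix (R : realType) (NS NT : nat)
    (h : 'I_NS -> 'cV[R[i]]_NT) : 'M[R[i]]_(NS, NT) :=
  (\matrix_(k < NT, l < NS) h l k 0) ^t*.

Definition sinr (R : realType) (NS NT : nat) (sigma_n2 : R)
    (h g : 'I_NS -> 'cV[R[i]]_NT) (l : 'I_NS) : R :=
  sqnorm (hdot (h l) (g l)) /
  (\sum_(i < NS | i != l) sqnorm (hdot (h l) (g i)) + sigma_n2).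

Definition sum_rate (R : realType) (NS NT : nat) (sigma_n2 : R)
    (h g : 'I_NS -> 'cV[R[i]]_NT) : R :=
  \sum_(l < NS) log2 (1 + sinr sigma_n2 h g l).

(* lambda lists the eigenvalues of A, with multiplicity and all real. *)
Definition eigenvalues_of (R : realType) (n : nat) (A : 'M[R[i]]_n)
    (lambda : 'I_n -> R) : Prop :=
  char_poly A = \prod_(mu < n) ('X - ((lambda mu)%:C)%:P).

Definition parallel_rates (R : realType) (n : nat) (P_Tx sigma_n2 : R)
    (lambda : 'I_n -> R) : set R :=
  [set r | exists p : 'I_n -> R,
     [/\ forall mu, 0 <= p mu,
         \sum_(mu < n) p mu = P_Tx &
         r = \sum_(mu < n) log2 (1 + lambda mu * (p mu / sigma_n2))]].

Definition is_maximum (R : realType) (S : set R) (x : R) : Prop :=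
  S x /\ ubound S x.

(* H H^H is Hermitian, so an eigenvalue list exists; it is unique up to order,
   and the order does not change the set of rates.  Hence C is unique. *)
Definition is_capacity (R : realType) (NS NT : nat) (P_Tx sigma_n2 : R)
    (h : 'I_NS -> 'cV[R[i]]_NT) (C : R) : Prop :=
  let H := channel_matrix h in
  exists2 lambda : 'I_NS -> R,
    eigenvalues_of (H *m H ^t*) lambda &
    is_maximum (parallel_rates P_Tx sigma_n2 lambda) C.

Definition precoder_per (R : realType) (NS NT : nat) (P_Tx sigma_n2 : R)
    (sigma_alpha2 : 'I_NS -> R) (a : 'I_NS -> 'cV[R[i]]_NT)
    (beta : 'I_NS -> R[i]) (l : 'I_NS) : 'cV[R[i]]_NT :=
  beta l *:
    (invmx (\sum_(i < NS) (sigma_alpha2 i)%:C *: (a i *m (a i) ^t*)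
            + ((NS%:R * sigma_n2 / P_Tx)%:C)%:M) *m a l).

(* Main.v *)
(* Orthogonality makes each a_l an eigenvector of the regularized covariance
   matrix, so g_l is a multiple of a_l, interference vanishes, and the rate is
   that of the uniform power allocation.  Since H H^H is a scalar matrix, the
   capacity is a maximum over parallel channels of equal gain, which by
   concavity of the logarithm is attained at the uniform allocation too. *)

Require Import Defs.
From HB Require Import structures.
From mathcomp Require Import all_boot all_order all_algebra.
From mathcomp Require Import spectral.
From mathcomp Require Import complex mxtens.
From mathcomp Require Import all_classical all_reals all_analysis.
From mathcomp Require Import ring.
Import Order.TTheory GRing.Theory Num.Theory.
Local Open Scope ring_scope.
Local Open Scope complex_scope.
Local Open Scope sesquilinear_scope.

Set Implicit Arguments.
Unset Strict Implicit.

(** A squared modulus is already a real element of [R[i]], so taking its real part loses nothing.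
    Identities for [sqnorm] can thus be proved in [R[i]] and pulled back by [complexI]. *)
Lemma sqnormE (R : realType) (z : R[i]) : (sqnorm z)%:C = `|z| ^+ 2.
Proof. by rewrite /sqnorm RRe_real // realX // normr_real. Qed.

Lemma sqnorm_ge0 (R : realType) (z : R[i]) : 0 <= sqnorm z.
Proof. by rewrite -ler0c sqnormE exprn_ge0. Qed.

Lemma sqnorm0 (R : realType) : sqnorm (0 : R[i]) = 0.
Proof. by apply: complexI; rewrite sqnormE normr0 expr0n. Qed.

Lemma sqnormM (R : realType) (y z : R[i]) :
  sqnorm (y * z) = sqnorm y * sqnorm z.
Proof. by apply: complexI; rewrite rmorphM /= !sqnormE normrM exprMn. Qed.

Lemma sqnormJ (R : realType) (z : R[i]) : sqnorm z^* = sqnorm z.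
Proof. by apply: complexI; rewrite !sqnormE norm_conjC. Qed.

Lemma sqnorm_nat (R : realType) (n : nat) :
  sqnorm (n%:R : R[i]) = n%:R ^+ 2.
Proof.
by apply: complexI; rewrite sqnormE normr_nat rmorphXn /= rmorph_nat.
Qed.

Lemma sqnorm_expj (R : realType) (t : R) : sqnorm (expj t) = 1.
Proof.
apply: complexI; rewrite sqnormE normc_def /= cos2Dsin2 sqrtr1.
by rewrite expr1n.
Qed.

Lemma hdotE (R : realType) (n : nat) (u v : 'cV[R[i]]_n) :
  hdot u v = \sum_i (u i 0)^* * v i 0.
Proof. by rewrite /hdot mxE; apply: eq_bigr => i _; rewrite !mxE. Qed.

Lemma hdotZl (R : realType) (n : nat) (c : R[i]) (u v : 'cV[R[i]]_n) :
  hdot (c *: u) v = c^* * hdot u v.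
Proof.
rewrite !hdotE big_distrr; apply: eq_bigr => i _ /=.
by rewrite mxE rmorphM mulrA.
Qed.

Lemma hdotZr (R : realType) (n : nat) (c : R[i]) (u v : 'cV[R[i]]_n) :
  hdot u (c *: v) = c * hdot u v.
Proof. by rewrite /hdot -scalemxAr mxE. Qed.

Lemma hdot_unimodular (R : realType) (n : nat) (u : 'cV[R[i]]_n) :
  (forall i, sqnorm (u i 0) = 1) -> hdot u u = n%:R.
Proof.
move=> u1; rewrite hdotE (eq_bigr (fun=> 1)) ?sumr_const ?card_ord //.
by move=> i _; rewrite mulrC -normCK -sqnormE u1.
Qed.

(** Each entry of the Kronecker product is a product of two phases, hence unimodular. *)
Lemma hdot_steering (R : realType) (nu DA : R) (Nx Ny : nat) (phix phiy : R) :
  hdot (steering nu DA Nx Ny phix phiy) (steering nu DA Nx Ny phix phiy)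
  = (Nx * Ny)%:R.
Proof.
by apply: hdot_unimodular => i; rewrite !mxE sqnormM !sqnorm_expj mulr1.
Qed.

(* No invertibility is needed: if M is singular, then invmx M = M, and if
   k = 0 while M is invertible, then v = 0. *)
Lemma invmx_eigenvector (F : fieldType) (n : nat) (M : 'M[F]_n)
    (v : 'cV[F]_n) (k : F) :
  M *m v = k *: v -> exists t, invmx M *m v = t *: v.
Proof.
move=> Mv; case: (boolP (M \in unitmx)) => [Mu | Mnu]; last first.
  by exists k; rewrite invmx_out.
have vE : v = k *: (invmx M *m v) by rewrite scalemxAr -Mv mulKmx.
have [k0 | k0] := eqVneq k 0.
  by exists 0; rewrite vE k0 !scale0r mulmx0.
by exists k^-1; rewrite {2}vE scalerA mulVf // scale1r.
Qed.

Lemma precoder_per_collinear (R : realType) (NS NT : nat) (P_Tx sigma_n2 : R)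
    (s : 'I_NS -> R) (a : 'I_NS -> 'cV[R[i]]_NT) (beta : 'I_NS -> R[i]) l :
  (forall i l, i != l -> hdot (a i) (a l) = 0) ->
  exists b, precoder_per P_Tx sigma_n2 s a beta l = b *: a l.
Proof.
move=> aO; set c := (NS%:R * sigma_n2 / P_Tx)%:C.
(* One formula covers both cases: for [i = l] the two sides coincide, and otherwise both vanish by
   orthogonality. The eigenvalue is then a sum over all [i], with no term to split off. *)
have aa i : (s i)%:C *: (a i *m (a i) ^t*) *m a l =
            ((s i)%:C * hdot (a i) (a l)) *: a l.
  rewrite -scalemxAl -mulmxA [_ ^t* *m _]mx11_scalar mul_mx_scalar scalerA.
  have [-> // | il] := eqVneq i l.
  by rewrite -/(hdot _ _) aO // mulr0 !scale0r.
have [|t tE] := @invmx_eigenvector _ _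
  (\sum_(i < NS) (s i)%:C *: (a i *m (a i) ^t*) + c%:M) (a l)
  (\sum_(i < NS) (s i)%:C * hdot (a i) (a l) + c).
  rewrite mulmxDl mulmx_suml mul_scalar_mx scalerDl scaler_suml.
  by congr (_ + _); apply: eq_bigr.
by exists (beta l * t); rewrite /precoder_per tE scalerA.
Qed.

Lemma log2M (R : realType) (x y : R) :
  0 < x -> 0 < y -> log2 (x * y) = log2 x + log2 y.
Proof. by move=> x0 y0; rewrite /log2 lnM ?posrE // mulrDl. Qed.

(** By concavity, the graph of the logarithm lies below its tangent at [y]; this is
    [ln (1 + t) <= t] at [t = x / y - 1]. *)
Lemma log2_tangent (R : realType) (x y : R) : 0 < x -> 0 < y ->
  log2 x <= log2 y + (x / y - 1) / ln 2.
Proof.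
move=> x0 y0; have xy0 : 0 < x / y by rewrite divr_gt0.
have ln2_gt0 : 0 < ln (2 : R) by rewrite ln_gt0 // ltr1n.
rewrite -[in log2 x](divfK (lt0r_neq0 y0) x) mulrC log2M // lerD2l.
rewrite ler_pM2r ?invr_gt0 //.
have := @le_ln1Dx R (x / y - 1); rewrite [1 + _]addrC subrK; apply.
by rewrite ltrBrDr addNr.
Qed.

(** Jensen's inequality: with all tangents taken at the mean [y], the linear corrections sum to
    zero. *)
Lemma sum_log2_le (R : realType) (n : nat) (x : 'I_n -> R) (y : R) :
  (forall i, 0 < x i) -> 0 < y -> \sum_i x i = n%:R * y ->
  \sum_i log2 (x i) <= n%:R * log2 y.
Proof.
move=> x0 y0 xE.
apply: le_trans (ler_sum _ (fun i _ => log2_tangent (x0 i) y0)) _.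
rewrite big_split /= sumr_const card_ord mulr_natl gerDl -mulr_suml.
rewrite sumrB -mulr_suml xE mulfK ?lt0r_neq0 // sumr_const card_ord.
by rewrite subrr mul0r.
Qed.

Lemma is_maximum_uniform (R : realType) (n : nat) (P_Tx sigma_n2 c : R) :
  (0 < n)%N -> 0 < P_Tx -> 0 < sigma_n2 -> 0 <= c ->
  is_maximum (parallel_rates P_Tx sigma_n2 (fun _ : 'I_n => c))
    (n%:R * log2 (1 + c * (P_Tx / n%:R / sigma_n2))).
Proof.
move=> n0 P0 s0 c0; have nR : 0 < n%:R :> R by rewrite ltr0n.
have gt0 p : 0 <= p -> 0 < 1 + c * (p / sigma_n2).
  by move=> p0; rewrite ltr_wpDr // mulr_ge0 // divr_ge0 // ltW.
split=> [| _ [p [p0 pP ->]]].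
  exists (fun=> P_Tx / n%:R); split=> [_||].
  - by rewrite divr_ge0 // ltW.
  - by rewrite sumr_const card_ord -[LHS]mulr_natr divfK // lt0r_neq0.
  - by rewrite sumr_const card_ord mulr_natl.
(* With equal gains, the power constraint fixes the sum of the arguments of the logarithms, and
   their mean is the argument for uniform power. *)
apply: sum_log2_le => [i||]; rewrite ?gt0 ?divr_ge0 // ?ltW //.
rewrite big_split /= sumr_const card_ord -mulr_sumr -mulr_suml pP mulrDr mulr1.
by congr (_ + _); field; rewrite !lt0r_neq0.
Qed.

Lemma channel_gram (R : realType) (NS NT : nat) (h : 'I_NS -> 'cV[R[i]]_NT)
    (k l : 'I_NS) :
  (channel_matrix h *m (channel_matrix h) ^t*) k l = hdot (h k) (h l).
Proof.
rewrite hdotE mxE; apply: eq_bigr => i _.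
by rewrite !mxE conjCK.
Qed.

Lemma is_capacity_orthogonal (R : realType) (NS NT : nat) (P_Tx sigma_n2 c : R)
    (h : 'I_NS -> 'cV[R[i]]_NT) :
  (0 < NS)%N -> 0 < P_Tx -> 0 < sigma_n2 -> 0 <= c ->
  (forall i l, i != l -> hdot (h i) (h l) = 0) ->
  (forall l, hdot (h l) (h l) = c%:C) ->
  is_capacity P_Tx sigma_n2 h
    (NS%:R * log2 (1 + c * (P_Tx / NS%:R / sigma_n2))).
Proof.
move=> NS0 P0 s0 c0 hO hc; exists (fun=> c); last exact: is_maximum_uniform.
rewrite /eigenvalues_of.
have -> : channel_matrix h *m (channel_matrix h) ^t* = (c%:C)%:M.
  apply/matrixP => k l; rewrite channel_gram mxE.
  by have [-> | kl] := eqVneq k l; rewrite ?hc ?hO.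
(* A scalar matrix is triangular, so its characteristic polynomial is read off the diagonal and
   every eigenvalue is [c]. *)
rewrite char_poly_trig ?scalar_mx_is_trig //.
by apply: eq_bigr => i _; rewrite mxE eqxx.
Qed.

Unset Implicit Arguments.
Set Strict Implicit.

Theorem corollary2 (R : realType)
    (d : measure_display) (T : measurableType d) (P : probability T R)
    (NS Nx Ny : nat) (hNS : (1 <= NS)%N) (hNT : (NS <= Nx * Ny)%N)
    (P_Tx sigma_n2 nu DA : R)
    (hP : 0 < P_Tx) (hsigma : 0 < sigma_n2) (hnu : 0 < nu) (hDA : 0 < DA)
    (phix phiy : 'I_NS -> R)
    (gain : 'I_NS -> T -> R[i])
    (hgain : forall l, complex_random_variable (gain l))
    (hgain2 : forall l, finite_second_moment P (gain l))
    (w : T) (beta : 'I_NS -> R[i]) :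
  let a := fun l => steering nu DA Nx Ny (phix l) (phiy l) in
  let alpha := fun l => gain l w in
  let h := fun l => alpha l *: a l in
  let sigma_alpha2 := fun l => second_moment P (gain l) in
  let g := precoder_per P_Tx sigma_n2 sigma_alpha2 a beta in
  (forall i l, i != l -> hdot (a i) (a l) = 0) ->
  (forall i l, i != l -> sqnorm (alpha i) = sqnorm (alpha l)) ->
  (forall l, hdot (g l) (g l) = (P_Tx / NS%:R)%:C) ->
  exists2 C : R, is_capacity P_Tx sigma_n2 h C & sum_rate sigma_n2 h g = C.
Proof.
move=> a alpha h sigma_alpha2 g aO alphaE gP.
set N := (Nx * Ny)%N in hNT *.
have aN l : hdot (a l) (a l) = N%:R by exact: hdot_steering.
(* The common path loss, read off at index 0, which exists because [NS] is positive. *)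
pose rho := sqnorm (alpha (Ordinal hNS)).
have rhoE l : sqnorm (alpha l) = rho.
  by have [-> // | /alphaE] := eqVneq l (Ordinal hNS).
(* Here [rho * N%:R] is the common squared norm of the channel vectors, and hence the gain of every
   parallel channel. *)
exists (NS%:R * log2 (1 + rho * N%:R * (P_Tx / NS%:R / sigma_n2))).
  apply: is_capacity_orthogonal => // [|i l il|l].
  - by rewrite mulr_ge0 ?sqnorm_ge0.
  - by rewrite hdotZl hdotZr aO // !mulr0.
  - rewrite hdotZl hdotZr aN mulrA [_^* * _]mulrC -normCK -sqnormE rhoE.
    by rewrite [RHS]rmorphM /= rmorph_nat.
rewrite /sum_rate mulr_natl -[X in _ = _ *+ X](card_ord NS) -sumr_const.
apply: eq_bigr => l _; congr (log2 (1 + _)); rewrite /sinr.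
(* Stated for every [i], to serve both the interference and the signal. The power normalization
   determines the modulus of the factor [b], and its phase does not affect the rate. *)
have hg i : exists2 b, hdot (h l) (g i) = (alpha l)^* * (b * hdot (a l) (a i))
                     & sqnorm b * N%:R = P_Tx / NS%:R.
  have [b gE] := precoder_per_collinear P_Tx sigma_n2 sigma_alpha2 beta i aO.
  exists b; first by rewrite hdotZl -hdotZr -gE.
  apply: complexI; rewrite -(gP i) /g gE hdotZl hdotZr aN mulrA [_^* * _]mulrC.
  by rewrite -normCK -sqnormE [LHS]rmorphM /= rmorph_nat.
rewrite big1 => [|i il]; last first.
  by have [b -> _] := hg i; rewrite aO 1?eq_sym // !mulr0 sqnorm0.
have [b -> bP] := hg l.
(* The signal power is [rho * sqnorm b * N^2]; one factor [N] joins [sqnorm b] to form the power per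
   stream, the other joins [rho] to form the channel gain. *)
rewrite aN !sqnormM sqnormJ rhoE sqnorm_nat -bP add0r expr2.
by rewrite !mulrA [rho * sqnorm b * _]mulrAC.
Qed.
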